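(* Let $\omega$ be a weight function and let $h>0$. Consider the conditions $$(\epsilon)_0\quad \int_0^\infty \omega(t)e^{-\mu t}\,dt<\infty\ \text{ for all }\mu>0,\qquad (\epsilon)_\infty\quad \int_0^\infty \omega(t)e^{-\mu t}\,dt<\infty\ \text{ for some }\mu>0.$$ The space $\mathcal{A}^h_{(\omega)}$ is non-trivial if and only if $\omega$ satisfies $(\epsilon)_0$, and the space $\mathcal{A}^h_{\{\omega\}}$ is non-trivial if and only if $\omega$ satisfies $(\epsilon)_\infty$. Consequently, $\mathcal{A}_{\{\omega\}}(\mathbb{R})$ is non-trivial if and only if $\omega$ satisfies $(\epsilon)_\infty$.
   Context: A weight function is a non-decreasing function $\omega:[0,\infty)\to[0,\infty)$, always assumed to satisfy $\lim_{t\to\infty}\omega(t)/\log t=\infty$; it is extended to $\mathbb{R}$ by $\omega(t)=\omega(|t|)$. Write $z=x+iy$ and $T^h=\mathbb{R}+i(-h,h)$. For $h,\lambda>0$, $\mathcal{A}_\omega^{h,\lambda}$ is the space of all analytic functions $\varphi$ on $T^h$ with $\|\varphi\|^{h,\lambda}:=\sup_{z\in T^h}|\varphi(z)|e^{\omega(\lambda x)}<\infty$. Then: - $\mathcal{A}^h_{(\omega)}=\bigcap_{0<k<h}\bigcap_{\lambda>0}\mathcal{A}_\omega^{k,\lambda}$ (analytic functions on $T^h$ with $\|\varphi\|^{k,\lambda}<\infty$ for all $0<k<h$, $\lambda>0$); - $\mathcal{A}^h_{\{\omega\}}=\bigcup_{k>h}\bigcup_{\lambda>0}\mathcal{A}_\omega^{k,\lambda}$;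 - $\mathcal{A}_{\{\omega\}}(\mathbb{R})=\bigcup_{h>0}\bigcup_{\lambda>0}\mathcal{A}_\omega^{h,\lambda}$. A space is non-trivial if it contains a function that is not identically zero. *)

(* Defs.v *)
From Stdlib Require Import Reals.
From Coquelicot Require Import Coquelicot.

Open Scope R_scope.

(* A weight function lives on [0,∞): the values of omega at negative arguments
   are unconstrained and never used, see [even_ext]. *)
Record weight_function (omega : R -> R) : Prop := {
  weight_nonneg : forall t, 0 <= t -> 0 <= omega t;
  weight_nondecreasing : forall s t, 0 <= s -> s <= t -> omega s <= omega t;
  weight_log : is_lim (fun t => omega t / ln t) p_infty p_infty
}.

Definition even_ext (omega : R -> R) (t : R) : R := omega (Rabs t).

Definition strip (h : R) (z : C) : Prop := - h < Im z < h.

(* A complex function on the strip of half-width [width]; the values of the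
   underlying total function outside of that strip are irrelevant. *)
Record strip_fun := StripFun { width : R; strip_val :> C -> C }.

Definition analytic_on (D : C -> Prop) (phi : C -> C) : Prop :=
  forall z, D z -> ex_derive (K := C_AbsRing) (V := C_NormedModule) phi z.

Definition weighted_norm (omega : R -> R) (h lambda : R) (phi : C -> C) : Rbar :=
  Lub_Rbar (fun r => exists z, strip h z /\
    r = Cmod (phi z) * exp (even_ext omega (lambda * Re z))).

Definition A_space (omega : R -> R) (h lambda : R) (phi : strip_fun) : Prop :=
  width phi = h /\ analytic_on (strip h) phi /\
  Rbar_lt (weighted_norm omega h lambda phi) p_infty.

Definition A_beurling (omega : R -> R) (h : R) (phi : strip_fun) : Prop :=
  width phi = h /\ analytic_on (strip h) phi /\
  forall k lambda, 0 < k < h -> 0 < lambda ->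
    Rbar_lt (weighted_norm omega k lambda phi) p_infty.

Definition A_roumieu (omega : R -> R) (h : R) (phi : strip_fun) : Prop :=
  exists k lambda, h < k /\ 0 < lambda /\ A_space omega k lambda phi.

Definition A_roumieu_real (omega : R -> R) (phi : strip_fun) : Prop :=
  exists h lambda, 0 < h /\ 0 < lambda /\ A_space omega h lambda phi.

Definition nontrivial (S : strip_fun -> Prop) : Prop :=
  exists phi, S phi /\ exists z, strip (width phi) z /\ phi z <> 0%C.

(* The integral over [0,∞) as a convergent improper Riemann integral; on every
   [0,a] the integrand is a product of monotone functions. *)
Definition exp_integrable (omega : R -> R) (mu : R) : Prop :=
  ex_RInt_gen (fun t => omega t * exp (- mu * t))
    (at_point 0) (Rbar_locally p_infty).

Definition eps_0 (omega : R -> R) : Prop :=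
  forall mu, 0 < mu -> exp_integrable omega mu.

Definition eps_infty (omega : R -> R) : Prop :=
  exists mu, 0 < mu /\ exp_integrable omega mu.

(* Main.v *)
Require Import Defs.
From Stdlib Require Import Reals Lra Lia IndefiniteDescription Classical.
From Coquelicot Require Import Coquelicot.

(** Both integral conditions are growth conditions in disguise. Since [omega] is
    non-decreasing, a convergent integral of [omega t * exp (- mu * t)] forces
    [omega t <= K * exp (mu * t)], and such a bound makes the integral converge for
    every larger exponent. So the first condition says that [omega] grows slower
    than every exponential, the second that it is dominated by some exponential
    ([exp_growth_of_exp_integrable], [exp_integrable_of_exp_growth]).

    If [omega] obeys such a bound, [z |-> exp (- A * cosh (a * z))] lies in the space:
    on a strip of half-width [k] with [a * k = PI / 3] its modulus is at most
    [exp (- A / 4 * exp (a * |x|))] ([Cmod_exp_cosh_le]). For the union spaces one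
    chooses [lambda] so that [omega (lambda * x)] is dominated by [exp (a * |x|)], and
    then [A]; for the intersection space [A = 1] serves all [lambda] simultaneously.

    Conversely, a non-zero bounded holomorphic function on a strip decays at most
    doubly exponentially, at a rate depending on the function and on the strip
    only ([decay_bound]). This is propagation of smallness along a chain of discs of
    radius [r] with centres [r / 4] apart: if [|f| <= 1] near the chain and [|f| <= eps]
    on one disc, then [|f|^4 <= eps] on the preceding one ([smallness_step]). To see
    this at a point [w], let [v] be the vector from [w] to the centre of the small disc,
    and multiply the four functions [f (w + v * c * z)], [c] a fourth root of unity:
    for every [|z| = 1] one of the four factors is evaluated in the small disc, so
    the product is at most [eps] on the unit circle, hence also at [0], where it is
    [f w ^ 4]. With [n] discs between a point [z0] and abscissa [t / lambda], smallness
    [exp (- omega t)] at the far end gives [omega t <= 4 ^ n * ln (1 / |f z0|)] with [n] of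
    order [t / lambda]. As the rate is proportional to [1 / lambda], having all [lambda]
    at one's disposal yields arbitrarily small exponents.

    The only complex analysis involved is the bound of a holomorphic function at
    the centre of a disc by its maximum on the circle ([Cmod_center_le]). It comes
    from the mean value property: the real and imaginary parts of [g (exp s)] satisfy
    the Cauchy-Riemann equations, so Goursat's bisection argument applied to
    rectangles of height [2 * PI] shows that the mean of [g] on a circle does not
    depend on its radius. Bisection is what lets the argument start from bare
    differentiability ([flux_divergence_free]). *)

Open Scope R_scope.

Lemma exp_le (x y : R) : x <= y -> exp x <= exp y.
Proof. intros [H | ->]; [now apply Rlt_le, exp_increasing | lra]. Qed.

(** * Complex derivatives *)

Notation cdiff := (ex_derive (K := C_AbsRing) (V := C_NormedModule)).

(** The two normed module structures on the complex numbers have different balls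
    but the same norm, and a derivative only sees the norm of the target. This
    gives access to the product and chain rules, which are stated for functions
    from a ring to itself. *)
Lemma is_derive_C_AbsRing (f : C -> C) (z l : C) :
  is_derive (K := C_AbsRing) (V := C_NormedModule) f z l <->
  is_derive (K := C_AbsRing) (V := AbsRing_NormedModule C_AbsRing) f z l.
Proof.
  split; intros [_ H]; (split; [apply is_linear_scal_l | exact H]).
Qed.

Lemma cdiff_const (c z : C) : cdiff (fun _ => c) z.
Proof. exists zero. apply is_derive_const. Qed.

Lemma cdiff_id (z : C) : cdiff (fun w => w) z.
Proof. exists one. apply is_derive_C_AbsRing, (is_derive_id (K := C_AbsRing)). Qed.

Lemma cdiff_plus (f g : C -> C) (z : C) :
  cdiff f z -> cdiff g z -> cdiff (fun w => (f w + g w)%C) z.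
Proof.
  intros [a Ha] [b Hb]. eexists.
  apply (is_derive_plus (V := C_NormedModule)); eassumption.
Qed.

Lemma cdiff_mult (f g : C -> C) (z : C) :
  cdiff f z -> cdiff g z -> cdiff (fun w => (f w * g w)%C) z.
Proof.
  intros [a Ha] [b Hb].
  exists (plus (mult (K := C_AbsRing) a (g z)) (mult (K := C_AbsRing) (f z) b)).
  apply is_derive_C_AbsRing.
  apply (is_derive_mult (K := C_AbsRing) f g);
    [now apply is_derive_C_AbsRing | now apply is_derive_C_AbsRing | exact Cmult_comm].
Qed.

Lemma cdiff_comp (f g : C -> C) (z : C) :
  cdiff f (g z) -> cdiff g z -> cdiff (fun w => f (g w)) z.
Proof.
  intros [a Ha] [b Hb].
  exists (scal (V := AbsRing_NormedModule C_AbsRing) b a).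
  apply is_derive_C_AbsRing.
  apply (is_derive_comp (K := C_AbsRing) (V := AbsRing_NormedModule C_AbsRing) f g z a b);
    now apply is_derive_C_AbsRing.
Qed.

Lemma is_derive_C_eps (f : C -> C) (z l : C) :
  is_derive (K := C_AbsRing) (V := C_NormedModule) f z l <->
  forall eps : posreal, exists delta : posreal, forall w : C,
    Cmod (w - z) < delta ->
    Cmod (f w - f z - (w - z) * l) <= eps * Cmod (w - z).
Proof.
  split.
  - intros [_ H] eps.
    destruct (H z (fun P HP => HP) eps) as [delta Hd].
    exists delta. exact Hd.
  - intros H. split; [apply is_linear_scal_l |].
    intros w Hw eps.
    assert (E : z = w)
      by exact (is_filter_lim_locally_unique (V := AbsRing_NormedModule C_AbsRing) _ _ Hw).
    subst w.
    destruct (H eps) as [delta Hd].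
    exists delta. exact Hd.
Qed.

Lemma Cmod_le_2Rmax (z : C) : Cmod z <= 2 * Rmax (Rabs (Re z)) (Rabs (Im z)).
Proof.
  eapply Rle_trans; [apply Cmod_2Rmax |].
  apply Rmult_le_compat_r.
  - eapply Rle_trans; [apply Rabs_pos | apply Rmax_l].
  - rewrite <- (sqrt_square 2) at 2 by lra. apply sqrt_le_1_alt. lra.
Qed.

Lemma im_le_Cmod (z : C) : Rabs (Im z) <= Cmod z.
Proof. eapply Rle_trans; [apply Rmax_r | apply (Rmax_Cmod z)]. Qed.

Lemma is_derive_C_cauchy_riemann (f : C -> C) (x y : R) (l : C) :
  is_derive (K := C_AbsRing) (V := C_NormedModule) f (x, y) l <->
  differentiable_pt_lim (fun u v => Re (f (u, v))) x y (Re l) (- Im l) /\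
  differentiable_pt_lim (fun u v => Im (f (u, v))) x y (Im l) (Re l).
Proof.
  rewrite is_derive_C_eps. split.
  - intros H.
    assert (K : forall eps : posreal, exists delta : posreal, forall u v,
      Rabs (u - x) < delta -> Rabs (v - y) < delta ->
      Cmod (f (u, v) - f (x, y) - ((u, v) - (x, y)) * l)%C
        <= eps * Rmax (Rabs (u - x)) (Rabs (v - y))).
    { intros eps.
      destruct (H (pos_div_2 eps)) as [delta Hd].
      exists (pos_div_2 delta). intros u v Hu Hv. simpl in *.
      assert (B := Cmod_le_2Rmax ((u, v) - (x, y))%C). simpl in B.
      unfold Re, Im in B; simpl in B.
      replace (u + - x) with (u - x) in B by ring.
      replace (v + - y) with (v - y) in B by ring.
      eapply Rle_trans; [apply Hd |].
      - eapply Rle_lt_trans; [exact B |].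
        assert (Rmax (Rabs (u - x)) (Rabs (v - y)) < delta / 2)
          by (apply Rmax_lub_lt; assumption).
        lra.
      - destruct eps as [e He]; simpl in *. nra. }
    split; intros eps; destruct (K eps) as [delta Hd]; exists delta;
      intros u v Hu Hv; eapply Rle_trans; try apply (Hd u v Hu Hv).
    + eapply Rle_trans; [| apply re_le_Cmod].
      apply Req_le. f_equal. unfold Re, Im; simpl. ring.
    + eapply Rle_trans; [| apply im_le_Cmod].
      apply Req_le. f_equal. unfold Re, Im; simpl. ring.
  - intros [Hre Him] eps.
    destruct (Hre (pos_div_2 eps)) as [d1 H1].
    destruct (Him (pos_div_2 eps)) as [d2 H2].
    assert (Hd : 0 < Rmin d1 d2) by (apply Rmin_pos; apply cond_pos).
    exists (mkposreal _ Hd). intros [u v] Hw. simpl in Hw.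
    assert (Bx := re_le_Cmod ((u, v) - (x, y))%C).
    assert (By := im_le_Cmod ((u, v) - (x, y))%C).
    unfold Re, Im in Bx, By; simpl in Bx, By.
    change (u + - x) with (u - x) in Bx. change (v + - y) with (v - y) in By.
    assert (M1 := Rmin_l d1 d2). assert (M2 := Rmin_r d1 d2).
    specialize (H1 u v ltac:(lra) ltac:(lra)).
    specialize (H2 u v ltac:(lra) ltac:(lra)).
    simpl in H1, H2.
    assert (M : Rmax (Rabs (u - x)) (Rabs (v - y)) <= Cmod ((u, v) - (x, y))%C)
      by (apply Rmax_lub; assumption).
    eapply Rle_trans; [apply Cmod_le_2Rmax |].
    apply Rle_trans with (2 * (eps / 2 * Rmax (Rabs (u - x)) (Rabs (v - y)))).
    + apply Rmult_le_compat_l; [lra |]. apply Rmax_lub.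
      * eapply Rle_trans; [| exact H1].
        apply Req_le. f_equal. unfold Re, Im; simpl. ring.
      * eapply Rle_trans; [| exact H2].
        apply Req_le. f_equal. unfold Re, Im; simpl. ring.
    + destruct eps as [e He]; simpl in *. nra.
Qed.

(** * The complex exponential *)

Definition Cexp (z : C) : C := (exp (Re z) * cos (Im z), exp (Re z) * sin (Im z)).

Lemma differentiable_pt_lim_Rmult (x y : R) :
  differentiable_pt_lim Rmult x y y x.
Proof.
  intros eps. exists eps. intros u v Hu Hv.
  replace (u * v - x * y - (y * (u - x) + x * (v - y)))
    with ((u - x) * (v - y)) by ring.
  rewrite Rabs_mult.
  apply Rmult_le_compat; try apply Rabs_pos; [lra | apply Rmax_r].
Qed.

Lemma differentiable_pt_lim_separated (f g : R -> R) (x y df dg : R) :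
  derivable_pt_lim f x df -> derivable_pt_lim g y dg ->
  differentiable_pt_lim (fun u v => f u * g v) x y (df * g y) (f x * dg).
Proof.
  intros Hf Hg.
  assert (H2 : differentiable_pt_lim (fun _ v => g v) x y 0 dg).
  { intros eps. destruct (differentiable_pt_lim_proj1_0 g y x dg Hg eps) as [d Hd].
    exists d. intros u v Hu Hv.
    specialize (Hd v u Hv Hu). simpl in Hd.
    rewrite Rmax_comm.
    replace (0 * (u - x) + dg * (v - y)) with (dg * (v - y) + 0 * (u - x)) by ring.
    exact Hd. }
  replace (df * g y) with (g y * df + f x * 0) by ring.
  replace (f x * dg) with (g y * 0 + f x * dg) by ring.
  apply (differentiable_pt_lim_comp Rmult (fun u _ => f u) (fun _ v => g v));
    [apply differentiable_pt_lim_Rmult | now apply differentiable_pt_lim_proj1_0 | exact H2].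
Qed.

Lemma cdiff_Cexp (z : C) : cdiff Cexp z.
Proof.
  destruct z as [x y]. exists (Cexp (x, y)).
  apply is_derive_C_cauchy_riemann. unfold Cexp, Re, Im; simpl. split.
  - replace (- (exp x * sin y)) with (exp x * - sin y) by ring.
    apply differentiable_pt_lim_separated;
      [apply derivable_pt_lim_exp | apply derivable_pt_lim_cos].
  - apply differentiable_pt_lim_separated;
      [apply derivable_pt_lim_exp | apply derivable_pt_lim_sin].
Qed.

Lemma Cmod_Cexp (z : C) : Cmod (Cexp z) = exp (Re z).
Proof.
  unfold Cmod, Cexp; simpl.
  replace (_ + _) with (Rsqr (exp (Re z)) * (Rsqr (sin (Im z)) + Rsqr (cos (Im z))))
    by (unfold Rsqr; ring).
  rewrite sin2_cos2, Rmult_1_r. apply sqrt_Rsqr, Rlt_le, exp_pos.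
Qed.

(** * Goursat's argument for divergence-free fields *)

(** Outward flux of the field [(P, - Q)] through the boundary of the rectangle
    [a <= x <= b], [c <= y <= d]. For [P = Re f] and [Q = Im f] it is the imaginary
    part of the contour integral of [f]. *)
Definition flux (P Q : R -> R -> R) (a b c d : R) : R :=
  RInt (fun y => P b y - P a y) c d - RInt (fun x => Q x d - Q x c) a b.

Definition cont_on (P : R -> R -> R) (a b c d : R) : Prop :=
  forall x y, a <= x <= b -> c <= y <= d -> continuity_2d_pt P x y.

Lemma ex_RInt_snd (P : R -> R -> R) (a b c d x : R) :
  cont_on P a b c d -> a <= x <= b -> c <= d -> ex_RInt (fun y => P x y) c d.
Proof.
  intros H Hx Hcd. apply (ex_RInt_continuous (V := R_CompleteNormedModule)).
  intros y Hy. rewrite Rmin_left, Rmax_right in Hy by lra.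
  apply continuity_pt_filterlim, continuity_pt_locally.
  intros eps. destruct (H x y Hx Hy eps) as [delta Hd].
  exists delta. intros v Hv. apply Hd; [| exact Hv].
  rewrite Rminus_diag, Rabs_R0. apply cond_pos.
Qed.

Lemma ex_RInt_fst (P : R -> R -> R) (a b c d y : R) :
  cont_on P a b c d -> c <= y <= d -> a <= b -> ex_RInt (fun x => P x y) a b.
Proof.
  intros H Hy Hab. apply (ex_RInt_snd (fun v u => P u v) c d a b); trivial.
  intros v u Hv Hu eps. destruct (H u v Hu Hv eps) as [delta Hd].
  exists delta. intros v' u' Hv' Hu'. now apply Hd.
Qed.

Lemma cont_on_sub (P : R -> R -> R) (a b c d a' b' c' d' : R) :
  cont_on P a b c d -> a <= a' -> b' <= b -> c <= c' -> d' <= d ->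
  cont_on P a' b' c' d'.
Proof. intros H Ha Hb Hc Hd x y Hx Hy. apply H; lra. Qed.

Lemma cont_on_transpose (P : R -> R -> R) (a b c d : R) :
  cont_on P a b c d -> cont_on (fun y x => P x y) c d a b.
Proof.
  intros H v u Hv Hu eps. destruct (H u v Hu Hv eps) as [delta Hd].
  exists delta. intros v' u' Hv' Hu'. now apply Hd.
Qed.

Lemma flux_transpose (P Q : R -> R -> R) (a b c d : R) :
  flux P Q a b c d = - flux (fun y x => Q x y) (fun y x => P x y) c d a b.
Proof. unfold flux. ring. Qed.

Lemma flux_split_fst (P Q : R -> R -> R) (a m b c d : R) :
  cont_on P a b c d -> cont_on Q a b c d -> a <= m <= b -> c <= d ->
  flux P Q a b c d = flux P Q a m c d + flux P Q m b c d.
Proof.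
  intros HP HQ Hm Hcd. unfold flux.
  rewrite <- (RInt_Chasles (fun x => Q x d - Q x c) a m b).
  2, 3: apply (ex_RInt_minus (V := R_NormedModule));
    apply (ex_RInt_fst _ _ _ c d); try lra; apply (cont_on_sub Q a b c d); lra || trivial.
  rewrite (RInt_ext (fun y => P b y - P a y)
    (fun y => plus (P b y - P m y) (P m y - P a y)))
    by (intros; unfold plus; simpl; ring).
  rewrite (RInt_plus (V := R_CompleteNormedModule)).
  2, 3: apply (ex_RInt_minus (V := R_NormedModule));
    apply (ex_RInt_snd _ a b); lra || trivial.
  unfold plus; simpl. ring.
Qed.

Lemma flux_split_snd (P Q : R -> R -> R) (a b c m d : R) :
  cont_on P a b c d -> cont_on Q a b c d -> a <= b -> c <= m <= d ->
  flux P Q a b c d = flux P Q a b c m + flux P Q a b m d.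
Proof.
  intros HP HQ Hab Hm.
  rewrite (flux_transpose P Q a b c d), (flux_transpose P Q a b c m),
    (flux_transpose P Q a b m d).
  rewrite (flux_split_fst _ _ c m d a b); try assumption; try ring;
    now apply cont_on_transpose.
Qed.

(** The equation [P_x = Q_y], [l] being the common value. *)
Definition divergence_free_at (P Q : R -> R -> R) (x y : R) : Prop :=
  exists p q l, differentiable_pt_lim P x y l p /\ differentiable_pt_lim Q x y q l.

(** The integrals of the affine parts of [P] and [Q] cancel because the two partial
    derivatives agree; only the error terms [eps * D] remain, integrated over
    sides of length at most [D]. *)
Lemma flux_local (P Q : R -> R -> R) (x0 y0 : R) (eps : posreal) :
  divergence_free_at P Q x0 y0 ->
  exists delta : posreal, forall a b c d D,
    a <= x0 <= b -> c <= y0 <= d -> b - a <= D -> d - c <= D -> D < delta ->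
    cont_on P a b c d -> cont_on Q a b c d ->
    Rabs (flux P Q a b c d) <= 4 * eps * D².
Proof.
  intros (p & q & l & HP & HQ).
  destruct (HP eps) as [d1 H1]. destruct (HQ eps) as [d2 H2].
  assert (Hd : 0 < Rmin d1 d2) by (apply Rmin_pos; apply cond_pos).
  exists (mkposreal _ Hd). simpl. intros a b c d D Hx Hy HD1 HD2 HD CP CQ.
  assert (M1 := Rmin_l d1 d2). assert (M2 := Rmin_r d1 d2).
  assert (He := cond_pos eps).
  assert (near : forall u v, a <= u <= b -> c <= v <= d ->
    Rabs (u - x0) <= D /\ Rabs (v - y0) <= D)
    by (intros u v Hu Hv; split; apply Rabs_le; lra).
  assert (EP : forall u v, a <= u <= b -> c <= v <= d ->
    Rabs (P u v - P x0 y0 - (l * (u - x0) + p * (v - y0))) <= eps * D).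
  { intros u v Hu Hv. destruct (near u v Hu Hv) as [N1 N2].
    eapply Rle_trans; [apply H1; lra |].
    apply Rmult_le_compat_l; [lra |]. now apply Rmax_lub. }
  assert (EQ : forall u v, a <= u <= b -> c <= v <= d ->
    Rabs (Q u v - Q x0 y0 - (q * (u - x0) + l * (v - y0))) <= eps * D).
  { intros u v Hu Hv. destruct (near u v Hu Hv) as [N1 N2].
    eapply Rle_trans; [apply H2; lra |].
    apply Rmult_le_compat_l; [lra |]. now apply Rmax_lub. }
  assert (JP : ex_RInt (fun y => P b y - P a y) c d).
  { apply (ex_RInt_minus (V := R_NormedModule) (fun y => P b y) (fun y => P a y));
      apply (ex_RInt_snd P a b c d); lra || trivial. }
  assert (JQ : ex_RInt (fun x => Q x d - Q x c) a b).
  { apply (ex_RInt_minus (V := R_NormedModule) (fun x => Q x d) (fun x => Q x c));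
      apply (ex_RInt_fst Q a b c d); lra || trivial. }
  assert (IP : Rabs (RInt (fun y => P b y - P a y - l * (b - a)) c d)
    <= (d - c) * (2 * eps * D)).
  { apply abs_RInt_le_const; [lra | |].
    - apply (ex_RInt_minus (V := R_NormedModule) (fun y => P b y - P a y));
        [exact JP | apply ex_RInt_const].
    - intros t Ht.
      assert (E1 := EP b t ltac:(lra) Ht). assert (E2 := EP a t ltac:(lra) Ht).
      apply Rabs_le_between in E1. apply Rabs_le_between in E2.
      apply Rabs_le. lra. }
  assert (IQ : Rabs (RInt (fun x => Q x d - Q x c - l * (d - c)) a b)
    <= (b - a) * (2 * eps * D)).
  { apply abs_RInt_le_const; [lra | |].
    - apply (ex_RInt_minus (V := R_NormedModule) (fun x => Q x d - Q x c));
        [exact JQ | apply ex_RInt_const].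
    - intros t Ht.
      assert (E1 := EQ t d Ht ltac:(lra)). assert (E2 := EQ t c Ht ltac:(lra)).
      apply Rabs_le_between in E1. apply Rabs_le_between in E2.
      apply Rabs_le. lra. }
  assert (RP : RInt (fun y => P b y - P a y - l * (b - a)) c d
    = RInt (fun y => P b y - P a y) c d - (d - c) * (l * (b - a))).
  { etransitivity.
    - exact (RInt_minus (V := R_CompleteNormedModule) (fun y => P b y - P a y)
        (fun _ => l * (b - a)) c d JP (ex_RInt_const _ _ _)).
    - now rewrite RInt_const. }
  assert (RQ : RInt (fun x => Q x d - Q x c - l * (d - c)) a b
    = RInt (fun x => Q x d - Q x c) a b - (b - a) * (l * (d - c))).
  { etransitivity.
    - exact (RInt_minus (V := R_CompleteNormedModule) (fun x => Q x d - Q x c)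
        (fun _ => l * (d - c)) a b JQ (ex_RInt_const _ _ _)).
    - now rewrite RInt_const. }
  rewrite RP in IP. rewrite RQ in IQ.
  unfold flux. apply Rabs_le_between in IP. apply Rabs_le_between in IQ.
  assert (B1 : (d - c) * (2 * eps * D) <= 2 * eps * D²)
    by (unfold Rsqr; replace (2 * eps * (D * D)) with (D * (2 * eps * D)) by ring;
        apply Rmult_le_compat_r; [apply Rmult_le_pos; lra | lra]).
  assert (B2 : (b - a) * (2 * eps * D) <= 2 * eps * D²)
    by (unfold Rsqr; replace (2 * eps * (D * D)) with (D * (2 * eps * D)) by ring;
        apply Rmult_le_compat_r; [apply Rmult_le_pos; lra | lra]).
  apply Rabs_le. lra.
Qed.

Lemma nested_intervals (u w : nat -> R) :
  (forall n, 0 <= w n) ->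
  (forall n, u n <= u (S n) /\ u (S n) + w (S n) <= u n + w n) ->
  exists x, forall n, u n <= x <= u n + w n.
Proof.
  intros Hw Hn.
  assert (up : forall n k, u n <= u (n + k)%nat).
  { intros n k. induction k; [rewrite Nat.add_0_r; lra |].
    rewrite Nat.add_succ_r. generalize (Hn (n + k)%nat). lra. }
  assert (down : forall n k, u (n + k)%nat + w (n + k)%nat <= u n + w n).
  { intros n k. induction k; [rewrite Nat.add_0_r; lra |].
    rewrite Nat.add_succ_r. generalize (Hn (n + k)%nat). lra. }
  assert (cross : forall m n, u m <= u n + w n).
  { intros m n. generalize (up m n), (down n m), (Hw (m + n)%nat).
    rewrite (Nat.add_comm n m). lra. }
  destruct (completeness (fun r => exists m, r = u m)) as [x [Hub Hlub]].
  - exists (u 0%nat + w 0%nat). intros r [m ->]. apply cross.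
  - exists (u 0%nat). now exists 0%nat.
  - exists x. intros n. split; [apply Hub; now exists n |].
    apply Hlub. intros r [m ->]. apply cross.
Qed.

(** Flux is additive under cutting a rectangle into four, so one quarter keeps at
    least a quarter of the flux; iterating, the flux of the [n]-th rectangle is at
    least [4 ^ - n] times the original one. The rectangles shrink to a point where
    [flux_local] bounds that flux by an arbitrarily small multiple of [4 ^ - n]. *)
Theorem flux_divergence_free (P Q : R -> R -> R) (a b c d : R) :
  a <= b -> c <= d ->
  (forall x y, a <= x <= b -> c <= y <= d -> divergence_free_at P Q x y) ->
  flux P Q a b c d = 0.
Proof.
  intros Hab Hcd Hdiv.
  assert (CP : cont_on P a b c d).
  { intros x y Hx Hy. destruct (Hdiv x y Hx Hy) as (p & q & l & HP & _).
    apply differentiable_continuity_pt. now exists l, p. }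
  assert (CQ : cont_on Q a b c d).
  { intros x y Hx Hy. destruct (Hdiv x y Hx Hy) as (p & q & l & _ & HQ).
    apply differentiable_continuity_pt. now exists q, l. }
  set (E := Rabs (flux P Q a b c d)).
  set (wx := fun n : nat => (b - a) / 2 ^ n).
  set (wy := fun n : nat => (d - c) / 2 ^ n).
  assert (pow2 : forall n, 0 < 2 ^ n) by (intros; apply pow_lt; lra).
  assert (wx0 : forall n, 0 <= wx n)
    by (intros; apply Rdiv_le_0_compat; [lra | apply pow2]).
  assert (wy0 : forall n, 0 <= wy n)
    by (intros; apply Rdiv_le_0_compat; [lra | apply pow2]).
  assert (wxS : forall n, wx n = 2 * wx (S n))
    by (intros n; unfold wx; simpl; field; apply Rgt_not_eq, pow2).
  assert (wyS : forall n, wy n = 2 * wy (S n))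
    by (intros n; unfold wy; simpl; field; apply Rgt_not_eq, pow2).
  set (good := fun n (z : R * R) =>
    a <= fst z /\ fst z + wx n <= b /\ c <= snd z /\ snd z + wy n <= d /\
    E <= 4 ^ n * Rabs (flux P Q (fst z) (fst z + wx n) (snd z) (snd z + wy n))).
  assert (step : forall n z, good n z -> exists z', good (S n) z' /\
    (fst z <= fst z' /\ fst z' + wx (S n) <= fst z + wx n) /\
    (snd z <= snd z' /\ snd z' + wy (S n) <= snd z + wy n)).
  { intros n [x y] (Ga & Gb & Gc & Gd & GE). simpl in Ga, Gb, Gc, Gd, GE.
    specialize (wxS n). specialize (wyS n).
    assert (px := wx0 (S n)). assert (py := wy0 (S n)).
    set (hx := wx (S n)) in *. set (hy := wy (S n)) in *.
    assert (pos4 : 0 < 4 ^ n) by (apply pow_lt; lra).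
    assert (quarter : exists x' y', (x' = x \/ x' = x + hx) /\ (y' = y \/ y' = y + hy) /\
      Rabs (flux P Q x (x + wx n) y (y + wy n))
        <= 4 * Rabs (flux P Q x' (x' + hx) y' (y' + hy))).
    { rewrite (flux_split_fst P Q x (x + hx)); try lra;
        try (apply (cont_on_sub _ a b c d); lra || trivial).
      rewrite (flux_split_snd P Q x (x + hx) y (y + hy)); try lra;
        try (apply (cont_on_sub _ a b c d); lra || trivial).
      rewrite (flux_split_snd P Q (x + hx) (x + wx n) y (y + hy)); try lra;
        try (apply (cont_on_sub _ a b c d); lra || trivial).
      replace (x + wx n) with (x + hx + hx) by lra.
      replace (y + wy n) with (y + hy + hy) by lra.
      set (f1 := flux _ _ x _ y _). set (f2 := flux _ _ x _ _ _).
      set (f3 := flux _ _ _ _ y _). set (f4 := flux _ _ _ _ _ _).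
      assert (T := Rabs_triang (f1 + f2) (f3 + f4)).
      assert (T1 := Rabs_triang f1 f2). assert (T2 := Rabs_triang f3 f4).
      set (S4 := Rabs (f1 + f2 + (f3 + f4))) in *.
      destruct (Rle_dec S4 (4 * Rabs f1)); [exists x, y; tauto |].
      destruct (Rle_dec S4 (4 * Rabs f2)); [exists x, (y + hy); tauto |].
      destruct (Rle_dec S4 (4 * Rabs f3)); [exists (x + hx), y; tauto |].
      exists (x + hx), (y + hy). repeat split; try tauto. fold f4. lra. }
    destruct quarter as (x' & y' & Hx' & Hy' & HE).
    exists (x', y'). unfold good; simpl. fold hx hy.
    repeat split; try (destruct Hx' as [-> | ->]; lra);
      try (destruct Hy' as [-> | ->]; lra).
    eapply Rle_trans; [exact GE |].
    replace (4 * 4 ^ n) with (4 ^ n * 4) by ring. rewrite Rmult_assoc.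
    apply Rmult_le_compat_l; lra. }
  assert (good0 : good 0%nat (a, c)).
  { unfold good, wx, wy; simpl. rewrite !Rdiv_1_r.
    replace (a + (b - a)) with b by ring. replace (c + (d - c)) with d by ring.
    fold E. lra. }
  pose (next := fun n (s : {z | good n z}) =>
    let t := constructive_indefinite_description _ (step n (proj1_sig s) (proj2_sig s)) in
    exist (good (S n)) (proj1_sig t) (proj1 (proj2_sig t))).
  pose (seq := fix seq n : {z | good n z} :=
    match n with O => exist _ _ good0 | S m => next m (seq m) end).
  set (z := fun n => proj1_sig (seq n)).
  assert (Hz : forall n, good n (z n)) by (intros n; apply (proj2_sig (seq n))).
  assert (Hnest : forall n,
    (fst (z n) <= fst (z (S n)) /\ fst (z (S n)) + wx (S n) <= fst (z n) + wx n) /\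
    (snd (z n) <= snd (z (S n)) /\ snd (z (S n)) + wy (S n) <= snd (z n) + wy n)).
  { intros n. unfold z. simpl. unfold next. simpl.
    destruct (constructive_indefinite_description _ _) as [t Ht]. apply Ht. }
  destruct (nested_intervals (fun n => fst (z n)) wx wx0 (fun n => proj1 (Hnest n)))
    as [x0 Hx0].
  destruct (nested_intervals (fun n => snd (z n)) wy wy0 (fun n => proj2 (Hnest n)))
    as [y0 Hy0].
  cbv beta in Hx0, Hy0.
  assert (D0 : divergence_free_at P Q x0 y0).
  { apply Hdiv; [generalize (Hx0 0%nat) | generalize (Hy0 0%nat)];
      unfold z, wx, wy; simpl; rewrite Rdiv_1_r; lra. }
  set (D := Rmax (b - a) (d - c)).
  assert (HD1 : b - a <= D) by apply Rmax_l.
  assert (HD2 : d - c <= D) by apply Rmax_r.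
  assert (small : forall eps : posreal, E <= 4 * eps * D²).
  { intros eps. destruct (flux_local P Q x0 y0 eps D0) as [delta Hd].
    destruct (pow_lt_1_zero (/ 2) ltac:(rewrite Rabs_pos_eq; lra) (delta / (D + 1)))
      as [n Hn]; [apply Rdiv_lt_0_compat; [apply cond_pos | lra] |].
    specialize (Hn n (Nat.le_refl n)).
    rewrite Rabs_pos_eq in Hn by (apply pow_le; lra).
    rewrite pow_inv in Hn.
    destruct (Hz n) as (Ga & Gb & Gc & Gd & GE).
    assert (p2 := pow2 n). assert (ip2 := Rinv_0_lt_compat _ p2).
    apply Rlt_div_r in Hn; [| lra].
    assert (HDn : D / 2 ^ n < delta) by (unfold Rdiv; nra).
    assert (F := Hd (fst (z n)) (fst (z n) + wx n) (snd (z n)) (snd (z n) + wy n)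
      (D / 2 ^ n) (Hx0 n) (Hy0 n)).
    assert (F' : Rabs (flux P Q (fst (z n)) (fst (z n) + wx n) (snd (z n)) (snd (z n) + wy n))
      <= 4 * eps * (D / 2 ^ n)²).
    { apply F; trivial.
      - unfold wx, Rdiv. ring_simplify (fst (z n) + (b - a) * / 2 ^ n - fst (z n)). nra.
      - unfold wy, Rdiv. ring_simplify (snd (z n) + (d - c) * / 2 ^ n - snd (z n)). nra.
      - apply (cont_on_sub _ a b c d); trivial.
      - apply (cont_on_sub _ a b c d); trivial. }
    eapply Rle_trans; [exact GE |].
    apply (Rmult_le_compat_l (4 ^ n)) in F'; [| apply pow_le; lra].
    eapply Rle_trans; [exact F' |]. apply Req_le.
    replace 4 with (2 * 2) at 1 by ring. rewrite Rpow_mult_distr.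
    unfold Rsqr. field. lra. }
  assert (E0 : E <= 0).
  { apply le_epsilon. intros eps He.
    assert (p : 0 < eps / (4 * (D² + 1)))
      by (apply Rdiv_lt_0_compat; [lra | generalize (Rle_0_sqr D); lra]).
    eapply Rle_trans; [apply (small (mkposreal _ p)) |]. simpl.
    assert (S0 := Rle_0_sqr D).
    replace (4 * (eps / (4 * (D² + 1))) * D²) with (eps * (D² / (D² + 1))) by (field; lra).
    assert (D² / (D² + 1) <= 1) by (apply Rle_div_l; lra). nra. }
  apply Rabs_eq_0. generalize (Rabs_pos (flux P Q a b c d)). fold E. lra.
Qed.

(** * A holomorphic function at the centre of a disc *)

Lemma cdiff_continuous (f : C -> C) (z : C) (eta : R) :
  cdiff f z -> 0 < eta ->
  exists delta : posreal, forall w, Cmod (w - z) < delta -> Cmod (f w - f z) < eta.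
Proof.
  intros [l Hl] Heta. destruct (proj1 (is_derive_C_eps f z l) Hl (mkposreal 1 Rlt_0_1))
    as [d Hd]. simpl in Hd.
  assert (Hl0 := Cmod_ge_0 l).
  assert (Hd' : 0 < Rmin d (eta / (2 + Cmod l))).
  { apply Rmin_pos; [apply cond_pos | apply Rdiv_lt_0_compat; lra]. }
  exists (mkposreal _ Hd'). simpl. intros w Hw.
  assert (H1 := Rmin_l d (eta / (2 + Cmod l))).
  assert (H2 := Rmin_r d (eta / (2 + Cmod l))).
  specialize (Hd w ltac:(lra)).
  replace (f w - f z)%C with ((f w - f z - (w - z) * l) + (w - z) * l)%C by ring.
  eapply Rle_lt_trans; [apply Cmod_triangle |].
  rewrite Cmod_mult.
  assert (H3 : Cmod (w - z) < eta / (2 + Cmod l)) by lra.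
  apply Rlt_div_r in H3; [| lra].
  generalize (Cmod_ge_0 (w - z)%C). nra.
Qed.

(** In the coordinate [s = x + i * y] with [w = exp s], the punctured disc is the
    half-plane [x <= 0] and circles are vertical segments of length [2 * PI]. By periodicity
    the horizontal sides of a rectangle contribute opposite amounts, so the integral
    of [Re g] over the unit circle equals that over a circle of radius [exp a], where
    [g] is as close to [g 0] as desired. *)
Lemma Re_center_le (g : C -> C) (M : R) :
  (forall w, Cmod w <= 1 -> cdiff g w) ->
  (forall w, Cmod w = 1 -> Cmod (g w) <= M) ->
  Re (g 0%C) <= M.
Proof.
  intros Hg HM. apply Rnot_lt_le. intros Hlt.
  set (eta := (Re (g 0%C) - M) / 2).
  assert (Heta : 0 < eta) by (unfold eta; lra).
  destruct (cdiff_continuous g 0%C eta) as [delta Hd]; [| exact Heta |].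
  { apply Hg. rewrite Cmod_0. lra. }
  assert (Hdelta := cond_pos delta).
  (* The inner circle has radius [exp a < delta], where [g] is within [eta] of [g 0]. *)
  set (a := Rmin 0 (ln (delta / 2))).
  assert (Ha0 : a <= 0) by apply Rmin_l.
  assert (Ha : exp a < delta).
  { apply Rle_lt_trans with (exp (ln (delta / 2))).
    - apply exp_le, Rmin_r.
    - rewrite exp_ln; lra. }
  set (P := fun x y => Re (g (Cexp (x, y)))).
  set (Q := fun x y => Im (g (Cexp (x, y)))).
  assert (HPI := PI_RGT_0).
  assert (Hdiv : forall x y, a <= x <= 0 -> 0 <= y <= 2 * PI -> divergence_free_at P Q x y).
  { intros x y Hx _.
    destruct (cdiff_comp g Cexp (x, y)) as [l Hl].
    - apply Hg. rewrite Cmod_Cexp. simpl.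
      rewrite <- exp_0. apply exp_le. unfold Re; simpl; lra.
    - apply cdiff_Cexp.
    - apply is_derive_C_cauchy_riemann in Hl. destruct Hl as [H1 H2].
      exists (- Im l), (Im l), (Re l). now split. }
  assert (F := flux_divergence_free P Q a 0 0 (2 * PI) Ha0 ltac:(lra) Hdiv).
  assert (CP : cont_on P a 0 0 (2 * PI)).
  { intros x y Hx Hy. destruct (Hdiv x y Hx Hy) as (p & q & l & HP & _).
    apply differentiable_continuity_pt. now exists l, p. }
  unfold flux in F.
  rewrite (RInt_ext (fun x => Q x (2 * PI) - Q x 0) (fun _ => 0)) in F.
  2: { intros x _. unfold Q, Cexp, Re, Im; simpl.
       rewrite cos_2PI, sin_2PI, cos_0, sin_0. ring. }
  rewrite RInt_const in F. unfold scal in F; simpl in F. unfold mult in F; simpl in F.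
  assert (I : RInt (fun y => P 0 y - P a y) 0 (2 * PI) <= RInt (fun _ => - eta) 0 (2 * PI)).
  { apply RInt_le; [lra | | apply ex_RInt_const |].
    - apply (ex_RInt_minus (V := R_NormedModule) (fun y => P 0 y) (fun y => P a y));
        apply (ex_RInt_snd P a 0 0 (2 * PI)); lra || trivial.
    - intros y _. unfold P.
      assert (B1 := re_le_Cmod (g (Cexp (0, y)))).
      assert (B2 := HM (Cexp (0, y)) ltac:(rewrite Cmod_Cexp; exact exp_0)).
      assert (B3 := re_le_Cmod (g (Cexp (a, y)) - g 0%C)%C).
      assert (B4 := Hd (Cexp (a, y))).
      replace (Cexp (a, y) - 0)%C with (Cexp (a, y)) in B4 by ring.
      rewrite Cmod_Cexp in B4. specialize (B4 Ha).
      unfold Cminus in B3. rewrite re_plus, re_opp in B3.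
      fold (Cminus (g (Cexp (a, y))) (g 0%C)) in B3.
      assert (B5 := Rle_abs (Re (g (Cexp (0, y))))).
      assert (B6 : Rabs (Re (g (Cexp (a, y))) + - Re (g 0%C)) < eta) by lra.
      apply Rabs_def2 in B6. unfold eta in *. lra. }
  rewrite RInt_const in I. unfold scal in I; simpl in I. unfold mult in I; simpl in I.
  assert (0 < PI * eta) by (apply Rmult_lt_0_compat; lra). lra.
Qed.

(** A rotation of [g] by the conjugate of [g 0] makes the value at the centre equal
    to its own modulus, which reduces the claim to real parts. *)
Lemma Cmod_center_le (g : C -> C) (M : R) :
  (forall w, Cmod w <= 1 -> cdiff g w) ->
  (forall w, Cmod w = 1 -> Cmod (g w) <= M) ->
  Cmod (g 0%C) <= M.
Proof.
  intros Hg HM.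
  assert (HM0 : 0 <= M).
  { eapply Rle_trans; [apply Cmod_ge_0 | apply (HM 1%C Cmod_1)]. }
  destruct (Rle_lt_or_eq_dec 0 (Cmod (g 0%C)) (Cmod_ge_0 _)) as [Hpos | E]; [| lra].
  assert (K := Re_center_le (fun w => (Cconj (g 0%C) * g w)%C) (Cmod (g 0%C) * M)).
  cbv beta in K. rewrite Cmult_comm, <- Cmod2_conj in K.
  assert (K' : Cmod (g 0%C) ^ 2 <= Cmod (g 0%C) * M).
  { rewrite <- (re_RtoC (Cmod (g 0%C) ^ 2)). apply K.
    - intros w Hw. apply cdiff_mult; [apply cdiff_const | now apply Hg].
    - intros w Hw. rewrite Cmod_mult, Cmod_conj.
      apply Rmult_le_compat_l; [lra | now apply HM]. }
  simpl in K'. rewrite Rmult_1_r in K'.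
  now apply Rmult_le_reg_l in K'.
Qed.

(** * Propagation of smallness along a strip *)

Lemma prod4_le (a b c d eps : R) :
  0 <= a <= 1 -> 0 <= b <= 1 -> 0 <= c <= 1 -> 0 <= d <= 1 ->
  a <= eps \/ b <= eps \/ c <= eps \/ d <= eps ->
  (a * b) * (c * d) <= eps.
Proof.
  intros Ha Hb Hc Hd H.
  assert (0 <= a * b <= 1) by nra. assert (0 <= c * d <= 1) by nra.
  assert (a * b <= a) by nra. assert (a * b <= b) by nra.
  assert (c * d <= c) by nra. assert (c * d <= d) by nra.
  assert ((a * b) * (c * d) <= a * b) by nra.
  assert ((a * b) * (c * d) <= c * d) by nra.
  lra.
Qed.

(** Some quarter turn brings [z] within an angle [PI / 4] of [1], where the real part
    is at least [sqrt 2 / 2 > 7 / 10] and hence [|z - 1|^2 <= 2 - 14 / 10 < (4 / 5)^2]. *)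
Lemma quarter_turn_near_1 (z : C) : Cmod z = 1 ->
  Cmod (1 * z - 1) <= 4 / 5 \/ Cmod (Ci * z - 1) <= 4 / 5 \/
  Cmod (- (1) * z - 1) <= 4 / 5 \/ Cmod (- Ci * z - 1) <= 4 / 5.
Proof.
  intros Hz.
  assert (near : forall w : C, Cmod w = 1 -> 7 / 10 <= Re w -> Cmod (w - 1) <= 4 / 5).
  { intros w Hw Hre. apply Rsqr_incr_0_var; [| lra].
    assert (H1 := Cmod2_alt (w - 1)%C). assert (H2 := Cmod2_alt w).
    rewrite Hw in H2. unfold Re, Im in *. simpl in *. unfold Rsqr. nra. }
  assert (H := Cmod2_alt z). rewrite Hz in H.
  assert (D : 7 / 10 <= Re z \/ Re z <= - (7 / 10) \/ 7 / 10 <= Im z \/ Im z <= - (7 / 10)).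
  { destruct (Rle_dec (7 / 10) (Re z)); [tauto |].
    destruct (Rle_dec (Re z) (- (7 / 10))); [tauto |].
    destruct (Rle_dec (7 / 10) (Im z)); [tauto |].
    destruct (Rle_dec (Im z) (- (7 / 10))); [tauto |]. exfalso. nra. }
  destruct D as [D | [D | [D | D]]].
  - left. apply near; [rewrite Cmod_mult, Cmod_1, Hz; ring |].
    unfold Re, Im in *; simpl in *; lra.
  - right; right; left. apply near; [rewrite Cmod_mult, Cmod_m1, Hz; ring |].
    unfold Re, Im in *; simpl in *; lra.
  - right; right; right. apply near; [rewrite Cmod_mult, Cmod_opp, Cmod_Ci, Hz; ring |].
    unfold Re, Im in *; simpl in *; lra.
  - right; left. apply near; [rewrite Cmod_mult, Cmod_Ci, Hz; ring |].
    unfold Re, Im in *; simpl in *; lra.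
Qed.

(** Here [|q - w| <= 5 / 4 * r], and the factor [4 / 5] of [quarter_turn_near_1] is
    exactly what brings one of the four rotated points back into the disc of
    radius [r] around [q]. *)
Lemma smallness_step (f : C -> C) (p q w : C) (r eps : R) :
  (forall u, Cmod (u - p) <= 3 * r -> cdiff f u /\ Cmod (f u) <= 1) ->
  Cmod (q - p) <= r / 4 ->
  (forall u, Cmod (u - q) <= r -> Cmod (f u) <= eps) ->
  Cmod (w - p) <= r -> Cmod (f w) ^ 4 <= eps.
Proof.
  intros Hf Hq Heps Hw.
  set (v := (q - w)%C).
  assert (Hv : Cmod v <= 5 / 4 * r).
  { replace v with ((q - p) + - (w - p))%C by (unfold v; ring).
    eapply Rle_trans; [apply Cmod_triangle |]. rewrite Cmod_opp. lra. }
  assert (Hr : 0 <= r) by (eapply Rle_trans; [apply Cmod_ge_0 | exact Hw]).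
  assert (in_disc : forall c z, Cmod c = 1 -> Cmod z <= 1 ->
    Cmod (w + v * (c * z) - p) <= 3 * r).
  { intros c z Hc Hz.
    replace (w + v * (c * z) - p)%C with ((w - p) + v * (c * z))%C by ring.
    eapply Rle_trans; [apply Cmod_triangle |].
    rewrite !Cmod_mult, Hc.
    generalize (Cmod_ge_0 v) (Cmod_ge_0 z). nra. }
  assert (m1 : Cmod (- (1)) = 1) by exact Cmod_m1.
  assert (mi : Cmod (- Ci) = 1) by (rewrite Cmod_opp; exact Cmod_Ci).
  set (F := fun c z => f (w + v * (c * z))%C).
  assert (dF : forall c z, Cmod c = 1 -> Cmod z <= 1 -> cdiff (F c) z).
  { intros c z Hc Hz. apply (cdiff_comp f (fun z => w + v * (c * z))%C).
    - now apply Hf, in_disc.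
    - apply cdiff_plus; [apply cdiff_const |].
      apply cdiff_mult; [apply cdiff_const |].
      apply cdiff_mult; [apply cdiff_const | apply cdiff_id]. }
  assert (bF : forall c z, Cmod c = 1 -> Cmod z <= 1 -> 0 <= Cmod (F c z) <= 1).
  { intros c z Hc Hz. split; [apply Cmod_ge_0 | now apply Hf, in_disc]. }
  assert (sF : forall c z, Cmod (c * z - 1) <= 4 / 5 -> Cmod (F c z) <= eps).
  { intros c z Hcz. apply Heps.
    replace (w + v * (c * z) - q)%C with (v * (c * z - 1))%C by (unfold v; ring).
    rewrite Cmod_mult. generalize (Cmod_ge_0 v) (Cmod_ge_0 (c * z - 1)%C). nra. }
  assert (K : Cmod ((F 1 0 * F Ci 0) * (F (- (1)) 0 * F (- Ci) 0))%C <= eps).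
  { apply (Cmod_center_le (fun z => (F 1 z * F Ci z) * (F (- (1)) z * F (- Ci) z))%C).
    - intros z Hz. apply cdiff_mult; apply cdiff_mult; apply dF; auto using Cmod_1, Cmod_Ci.
    - intros z Hz. rewrite !Cmod_mult.
      apply prod4_le; try (apply bF; auto using Cmod_1, Cmod_Ci; lra).
      destruct (quarter_turn_near_1 z Hz) as [D | [D | [D | D]]]; apply sF in D; tauto. }
  assert (F0 : forall c, F c 0%C = f w).
  { intros c. unfold F. f_equal. ring. }
  rewrite !F0, !Cmod_mult in K. simpl. lra.
Qed.

(** The induction applies its hypothesis to [f ^ 4], on which [smallness_step] has
    just moved the smallness one disc closer to [p]; this avoids taking fourth
    roots of [eps]. *)
Lemma smallness_chain (n : nat) : forall (f : C -> C) (p : C) (r eps : R),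
  0 < r ->
  (forall u, Rabs (Im u - Im p) <= 3 * r -> cdiff f u /\ Cmod (f u) <= 1) ->
  (forall u, Cmod (u - (p + RtoC (INR n * (r / 4)))) <= r -> Cmod (f u) <= eps) ->
  Cmod (f p) ^ (4 ^ n) <= eps.
Proof.
  induction n as [| n IH]; intros f p r eps Hr Hf Heps.
  - simpl. rewrite Rmult_1_r. apply Heps.
    change (INR 0) with 0. rewrite Rmult_0_l.
    replace (p - (p + 0))%C with (RtoC 0) by ring. rewrite Cmod_0. lra.
  - set (g := fun u => ((f u * f u) * (f u * f u))%C).
    assert (Hg : forall u, Cmod (g u) = Cmod (f u) ^ 4).
    { intros u. unfold g. rewrite !Cmod_mult. ring. }
    assert (K : Cmod (g p) ^ (4 ^ n) <= eps).
    { apply (IH g p r eps Hr).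
      - intros u Hu. destruct (Hf u Hu) as [D B]. split.
        + apply cdiff_mult; now apply cdiff_mult.
        + rewrite Hg, <- (pow1 4). apply pow_incr. split; [apply Cmod_ge_0 | exact B].
      - intros u Hu. rewrite Hg.
        set (c := (p + RtoC (INR n * (r / 4)))%C) in *.
        apply (smallness_step f c (c + RtoC (r / 4)) u r eps).
        + intros v Hv. apply Hf.
          eapply Rle_trans; [| exact Hv].
          eapply Rle_trans; [| apply im_le_Cmod].
          apply Req_le. f_equal. unfold c, Im; simpl. ring.
        + replace (c + RtoC (r / 4) - c)%C with (RtoC (r / 4)) by ring.
          rewrite Cmod_R, Rabs_pos_eq; lra.
        + intros v Hv. apply Heps.
          replace (p + RtoC (INR (S n) * (r / 4)))%C with (c + RtoC (r / 4))%C; [exact Hv |].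
          unfold c. rewrite S_INR, <- Cplus_assoc, <- RtoC_plus. f_equal. f_equal. ring.
        + exact Hu. }
    rewrite Hg, <- pow_mult in K. rewrite Nat.pow_succ_r'. exact K.
Qed.

Lemma four_le_exp_2 : 4 <= exp 2.
Proof.
  replace 2 with (1 + 1) by ring. rewrite exp_plus.
  generalize (exp_ineq1_le 1). nra.
Qed.

(** The rate [mu0] is chosen before [omega] and [lambda]. The intersection space
    depends on this: there [lambda] is sent to infinity for a fixed function. *)
Lemma decay_bound (phi : C -> C) (k : R) (z0 : C) :
  analytic_on (strip k) phi -> strip k z0 -> phi z0 <> 0%C ->
  exists mu0, 0 < mu0 /\ forall omega lambda M,
    weight_function omega -> 0 < lambda ->
    (forall z, strip k z -> Cmod (phi z) * exp (even_ext omega (lambda * Re z)) <= M) ->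
    exists K, forall t, 0 <= t -> omega t <= K * exp (mu0 / lambda * t).
Proof.
  intros Han Hz0 Hnz.
  apply Cmod_gt_0 in Hnz.
  (* All discs involved stay within [3 * r] of the horizontal line through [z0]. *)
  set (r := (k - Rabs (Im z0)) / 4).
  assert (Hr : 0 < r).
  { unfold r. unfold strip in Hz0.
    assert (Rabs (Im z0) < k) by (apply Rabs_def1; lra). lra. }
  exists (8 / r). split; [apply Rdiv_lt_0_compat; lra |].
  intros omega lambda M Homega Hlambda HM.
  assert (w0 : forall x, 0 <= even_ext omega x)
    by (intros x; apply (weight_nonneg _ Homega), Rabs_pos).
  assert (HM0 : 0 < M).
  { eapply Rlt_le_trans; [| exact (HM z0 Hz0)].
    apply Rmult_lt_0_compat; [exact Hnz | apply exp_pos]. }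
  set (f := fun z => (phi z * RtoC (/ M))%C).
  assert (Hf : forall z, strip k z -> Cmod (f z) <= exp (- even_ext omega (lambda * Re z))).
  { intros z Hz. unfold f. rewrite Cmod_mult, Cmod_R, Rabs_pos_eq
      by (apply Rlt_le, Rinv_0_lt_compat, HM0).
    rewrite exp_Ropp. apply Rle_div_l; [exact HM0 |].
    rewrite Rmult_comm. apply Rle_div_r; [apply exp_pos |]. now apply HM. }
  assert (Hf0 : 0 < Cmod (f z0)).
  { unfold f. rewrite Cmod_mult, Cmod_R, Rabs_pos_eq
      by (apply Rlt_le, Rinv_0_lt_compat, HM0).
    apply Rmult_lt_0_compat; [exact Hnz | now apply Rinv_0_lt_compat]. }
  assert (Hin : forall u, Rabs (Im u - Im z0) <= 3 * r -> strip k u).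
  { intros u Hu. unfold strip.
    assert (T := Rabs_triang (Im u - Im z0) (Im z0)).
    replace (Im u - Im z0 + Im z0) with (Im u) in T by ring.
    assert (Rabs (Im u) < k) by (unfold r in *; lra).
    now apply Rabs_def2 in H as [H1 H2]. }
  assert (Hf1 : forall u, strip k u -> Cmod (f u) <= 1).
  { intros u Hu. eapply Rle_trans; [now apply Hf |].
    rewrite <- exp_0. apply exp_le. generalize (w0 (lambda * Re u)). lra. }
  set (L := - ln (Cmod (f z0))).
  assert (HL : 0 <= L).
  { unfold L. generalize (ln_le _ 1 Hf0 (Hf1 z0 Hz0)). rewrite ln_1. lra. }
  (* [s] discs bring the centre to abscissa [r], so that the disc lies to the right
     of [0]; each further unit of [t / lambda] costs [4 / r] more. *)
  set (s := (r + Rabs (Re z0)) * 4 / r).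
  exists (L * exp (2 * (s + 1))). intros t Ht.
  set (y := s + 4 / r / lambda * t).
  assert (Hy : 0 <= y).
  { assert (0 < / r) by now apply Rinv_0_lt_compat.
    assert (0 < / lambda) by now apply Rinv_0_lt_compat.
    assert (Ha := Rabs_pos (Re z0)).
    unfold y, s, Rdiv. apply Rplus_le_le_0_compat; repeat apply Rmult_le_pos; lra. }
  destruct (nfloor_ex y Hy) as [n [Hn1 Hn2]].
  assert (K : Cmod (f z0) ^ (4 ^ (S n)) <= exp (- omega t)).
  { apply (smallness_chain (S n) f z0 r (exp (- omega t)) Hr).
    - intros u Hu. split; [| now apply Hf1, Hin].
      apply cdiff_mult; [now apply Han, Hin | apply cdiff_const].
    - intros u Hu.
      assert (B1 := im_le_Cmod (u - (z0 + RtoC (INR (S n) * (r / 4))))%C).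
      assert (B2 := re_le_Cmod (u - (z0 + RtoC (INR (S n) * (r / 4))))%C).
      replace (Im (u - _)%C) with (Im u - Im z0) in B1 by (unfold Im; simpl; ring).
      replace (Re (u - _)%C) with (Re u - Re z0 - INR (S n) * (r / 4)) in B2
        by (unfold Re; simpl; ring).
      eapply Rle_trans; [apply Hf, Hin; lra |].
      apply exp_le, Ropp_le_contravar. unfold even_ext.
      apply (weight_nondecreasing _ Homega); [exact Ht |].
      assert (B3 : Rabs (Re u - Re z0 - INR (S n) * (r / 4)) <= r) by lra.
      apply Rabs_le_between in B3.
      rewrite S_INR in *.
      assert (B4 : (INR n + 1) * (r / 4) >= t / lambda + r + Rabs (Re z0)).
      { replace (t / lambda + r + Rabs (Re z0)) with (y * (r / 4))
          by (unfold y, s; field; lra).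
        apply Rle_ge, Rmult_le_compat_r; lra. }
      assert (B5 : - Re z0 <= Rabs (Re z0)) by (rewrite <- Rabs_Ropp; apply Rle_abs).
      eapply Rle_trans; [| apply Rle_abs].
      rewrite Rmult_comm. apply Rle_div_l; lra. }
  apply ln_le in K; [| now apply pow_lt].
  rewrite ln_exp, ln_pow in K by exact Hf0.
  assert (K2 : omega t <= L * INR (4 ^ S n)) by (unfold L; lra).
  eapply Rle_trans; [exact K2 |].
  rewrite Rmult_assoc, <- exp_plus. apply Rmult_le_compat_l; [exact HL |].
  rewrite pow_INR. simpl (INR 4).
  eapply Rle_trans.
  - apply pow_incr. split; [lra |].
    replace (1 + 1 + 1 + 1) with 4 by ring. exact four_le_exp_2.
  - rewrite <- Rpower_pow by apply exp_pos. unfold Rpower. rewrite ln_exp.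
    apply exp_le. rewrite S_INR. unfold y in *.
    replace (8 / r / lambda * t) with (2 * (4 / r / lambda * t)) by (field; lra). lra.
Qed.

(** * The integral conditions as growth conditions *)

Lemma ex_RInt_up_set (U : R -> bool) (g : R -> R) (a b : R) :
  a <= b -> (forall s t, a <= s -> s <= t -> t <= b -> U s = true -> U t = true) ->
  ex_RInt g a b -> ex_RInt (fun t => if U t then g t else 0) a b.
Proof.
  intros Hab HU Hg.
  destruct (completeness (fun t => t = a \/ (a <= t <= b /\ U t = false))) as [c [Hub Hlub]].
  - exists b. intros t [-> | Ht]; lra.
  - exists a. now left.
  - assert (Hac : a <= c) by (apply Hub; now left).
    assert (Hcb : c <= b) by (apply Hlub; intros t [-> | Ht]; lra).
    apply (ex_RInt_Chasles _ a c b).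
    + apply (ex_RInt_ext (fun _ => 0)); [| apply ex_RInt_const].
      intros t Ht. rewrite Rmin_left, Rmax_right in Ht by lra.
      destruct (U t) eqn:E; [exfalso | reflexivity].
      assert (c <= t); [| lra].
      apply Hlub. intros s [-> | [Hs Es]]; [lra |].
      apply Rnot_lt_le. intros Hts. rewrite (HU t s) in Es; [discriminate | lra ..| exact E].
    + apply (ex_RInt_ext g).
      * intros t Ht. rewrite Rmin_left, Rmax_right in Ht by lra.
        destruct (U t) eqn:E; [reflexivity | exfalso].
        assert (t <= c); [| lra]. apply Hub. right. split; [lra | exact E].
      * now apply (ex_RInt_Chasles_2 g a).
Qed.

(** Peeling off the set where [m] takes its top value lowers the range of [m] by
    one, and that set is an up-set, hence an interval ending at [b]. *)
Lemma ex_RInt_monotone_integer (g : R -> R) (a b : R) :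
  a <= b -> ex_RInt g a b -> forall (n : nat) (m : R -> Z),
  (forall s t, a <= s -> s <= t -> t <= b -> (m s <= m t)%Z) ->
  (m b <= m a + Z.of_nat n)%Z -> ex_RInt (fun t => IZR (m t) * g t) a b.
Proof.
  intros Hab Hg. induction n as [| n IH]; intros m Hm Hn.
  - apply (ex_RInt_ext (fun t => scal (IZR (m a)) (g t))).
    + intros t Ht. rewrite Rmin_left, Rmax_right in Ht by lra.
      unfold scal; simpl; unfold mult; simpl. f_equal. f_equal.
      assert (H1 := Hm a t ltac:(lra) ltac:(lra) ltac:(lra)).
      assert (H2 := Hm t b ltac:(lra) ltac:(lra) ltac:(lra)). lia.
    + now apply (ex_RInt_scal (V := R_NormedModule)).
  - set (low := fun t => Z.min (m t) (m b - 1)).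
    set (top := fun t => Z.leb (m b) (m t)).
    apply (ex_RInt_ext (fun t => plus (IZR (low t) * g t) (if top t then g t else 0))).
    + intros t Ht. rewrite Rmin_left, Rmax_right in Ht by lra.
      assert (H2 := Hm t b ltac:(lra) ltac:(lra) ltac:(lra)).
      unfold plus, low, top; simpl. destruct (Z.leb_spec (m b) (m t)).
      * rewrite Z.min_r by lia. replace (m t) with (m b) by lia.
        rewrite minus_IZR. ring.
      * rewrite Z.min_l by lia. ring.
    + apply (ex_RInt_plus (V := R_NormedModule)).
      * apply IH; unfold low.
        -- intros s t H1 H2 H3. generalize (Hm s t H1 H2 H3). lia.
        -- assert (H := Hm a b ltac:(lra) ltac:(lra) ltac:(lra)). lia.
      * apply ex_RInt_up_set; [exact Hab | | exact Hg].
        intros s t H1 H2 H3 E. apply Z.leb_le in E. apply Z.leb_le.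
        generalize (Hm s t H1 H2 H3). lia.
Qed.

(** Rounding [(n + 1) * f] down to integers approximates [f] uniformly within
    [1 / (n + 1)] by functions covered by [ex_RInt_monotone_integer]. *)
Lemma ex_RInt_monotone_mult (f g : R -> R) (a b B : R) :
  a <= b -> (forall s t, a <= s -> s <= t -> t <= b -> f s <= f t) ->
  ex_RInt g a b -> (forall t, a <= t <= b -> Rabs (g t) <= B) ->
  ex_RInt (fun t => f t * g t) a b.
Proof.
  intros Hab Hf Hg HB.
  set (m := fun (n : nat) t => Int_part ((INR n + 1) * f t)).
  assert (Hfloor : forall n t, IZR (m n t) <= (INR n + 1) * f t < IZR (m n t) + 1).
  { intros n t. unfold m. generalize (base_Int_part ((INR n + 1) * f t)). lra. }
  (* Uniform convergence is required on the whole line, so the approximations are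
     exact outside of the interval. *)
  set (approx := fun (n : nat) t =>
    if Rle_dec a t then if Rle_dec t b then / (INR n + 1) * (IZR (m n t) * g t)
    else f t * g t else f t * g t).
  assert (Happrox : forall n t, a <= t <= b ->
    approx n t = / (INR n + 1) * (IZR (m n t) * g t)).
  { intros n t Ht. unfold approx.
    destruct (Rle_dec a t); [| lra]. destruct (Rle_dec t b); [reflexivity | lra]. }
  assert (Hint : forall n, ex_RInt (approx n) a b).
  { intros n. apply (ex_RInt_ext (fun t => scal (/ (INR n + 1)) (IZR (m n t) * g t))).
    - intros t Ht. rewrite Rmin_left, Rmax_right in Ht by lra.
      now rewrite Happrox by lra.
    - apply (ex_RInt_scal (V := R_NormedModule)).
      apply (ex_RInt_monotone_integer g a b Hab Hg (Z.to_nat (m n b - m n a))).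
      + intros s t H1 H2 H3.
        assert (F1 := Hfloor n s). assert (F2 := Hfloor n t).
        assert (F := Hf s t H1 H2 H3).
        assert (Hn := pos_INR n).
        assert ((INR n + 1) * f s <= (INR n + 1) * f t)
          by (apply Rmult_le_compat_l; lra).
        apply Z.lt_succ_r, lt_IZR. unfold Z.succ. rewrite plus_IZR. lra.
      + lia. }
  assert (HB0 : 0 <= B)
    by (eapply Rle_trans; [apply Rabs_pos | apply (HB a); lra]).
  destruct (filterlim_RInt (V := R_CompleteNormedModule) approx a b eventually _
    (fun t => f t * g t) (fun n => RInt (approx n) a b)) as [I [_ HI]].
  - intros n. apply (RInt_correct (V := R_CompleteNormedModule)), Hint.
  - intros P [eps HP].
    destruct (nfloor_ex (B / eps)) as [N [_ HN]].
    { apply Rdiv_le_0_compat; [exact HB0 | apply cond_pos]. }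
    exists N. intros n Hn. apply HP. intros t.
    unfold ball; simpl. unfold AbsRing_ball, abs, minus, plus, opp; simpl.
    destruct (Rle_dec a t) as [Ha |];
      [destruct (Rle_dec t b) as [Hb |] |].
    2, 3: unfold approx; destruct (Rle_dec a t); try destruct (Rle_dec t b); try lra;
      rewrite Rplus_opp_r, Rabs_R0; apply cond_pos.
    rewrite Happrox by lra.
    assert (Heps := cond_pos eps).
    apply le_INR in Hn. assert (Hn0 := pos_INR n).
    replace (_ + _) with (/ (INR n + 1) * ((IZR (m n t) - (INR n + 1) * f t) * g t))
      by (field; lra).
    rewrite !Rabs_mult, (Rabs_pos_eq (/ _)) by (apply Rlt_le, Rinv_0_lt_compat; lra).
    assert (F := Hfloor n t).
    assert (A : Rabs (IZR (m n t) - (INR n + 1) * f t) <= 1) by (apply Rabs_le; lra).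
    assert (Bt := HB t ltac:(lra)).
    apply Rlt_div_l in HN; [| exact Heps].
    rewrite Rmult_comm. apply Rlt_div_l; [lra |].
    assert (P1 := Rabs_pos (IZR (m n t) - (INR n + 1) * f t)).
    assert (P2 := Rabs_pos (g t)). nra.
  - now exists I.
Qed.

Lemma ex_RInt_weight_exp (omega : R -> R) (mu b : R) :
  weight_function omega -> 0 <= mu -> 0 <= b ->
  ex_RInt (fun t => omega t * exp (- mu * t)) 0 b.
Proof.
  intros Homega Hmu Hb.
  apply (ex_RInt_monotone_mult omega _ 0 b 1 Hb).
  - intros s t H1 H2 _. now apply (weight_nondecreasing _ Homega).
  - apply (ex_RInt_continuous (V := R_CompleteNormedModule)). intros t _.
    apply (ex_derive_continuous (V := R_NormedModule)). auto_derive. trivial.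
  - intros t Ht. rewrite Rabs_pos_eq by apply Rlt_le, exp_pos.
    rewrite <- exp_0. apply exp_le. nra.
Qed.

(** By monotonicity [omega t] is at most [exp (mu * (t + 1))] times the integral over
    [t <= s <= t + 1], a piece of a convergent integral of a nonnegative function. *)
Lemma exp_growth_of_exp_integrable (omega : R -> R) (mu : R) :
  weight_function omega -> 0 < mu -> exp_integrable omega mu ->
  exists K, forall t, 0 <= t -> omega t <= K * exp (mu * t).
Proof.
  intros Homega Hmu [l Hl].
  set (f := fun t => omega t * exp (- mu * t)) in *.
  destruct (Hl (ball l (mkposreal 1 Rlt_0_1))) as [A S HA [b0 HS] H];
    [apply locally_ball |].
  unfold at_point in HA.
  exists ((l + 1) * exp mu). intros t Ht.
  set (b := Rmax (b0 + 1) (t + 1)).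
  assert (Hb1 : b0 + 1 <= b) by apply Rmax_l.
  assert (Hb2 : t + 1 <= b) by apply Rmax_r.
  destruct (H 0 b HA (HS b ltac:(lra))) as [y [Hy Hly]].
  simpl in Hy.
  unfold ball in Hly; simpl in Hly.
  unfold AbsRing_ball, abs, minus, plus, opp in Hly; simpl in Hly.
  apply Rabs_def2 in Hly.
  apply (is_RInt_unique (V := R_CompleteNormedModule)) in Hy.
  assert (Hf0 : forall s, 0 <= s -> 0 <= f s).
  { intros s Hs. apply Rmult_le_pos;
      [now apply (weight_nonneg _ Homega) | apply Rlt_le, exp_pos]. }
  assert (Hex : forall c d, 0 <= c -> c <= d -> ex_RInt f c d).
  { intros c d Hc Hd. apply (ex_RInt_Chasles_2 (V := R_CompleteNormedModule) f 0); [lra |].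
    apply ex_RInt_weight_exp; trivial; lra. }
  rewrite <- (RInt_Chasles f 0 t b) in Hy by (apply Hex; lra).
  rewrite <- (RInt_Chasles f t (t + 1) b) in Hy by (apply Hex; lra).
  unfold plus in Hy; simpl in Hy.
  assert (P1 : 0 <= RInt f 0 t).
  { apply RInt_ge_0; [lra | apply Hex; lra | intros; apply Hf0; lra]. }
  assert (P2 : 0 <= RInt f (t + 1) b).
  { apply RInt_ge_0; [lra | apply Hex; lra | intros; apply Hf0; lra]. }
  assert (P3 : RInt (fun _ => omega t * exp (- mu * (t + 1))) t (t + 1) <= RInt f t (t + 1)).
  { apply RInt_le; [lra | apply ex_RInt_const | apply Hex; lra |].
    intros s Hs. apply Rmult_le_compat.
    - now apply (weight_nonneg _ Homega).
    - apply Rlt_le, exp_pos.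
    - apply (weight_nondecreasing _ Homega); lra.
    - apply exp_le. nra. }
  rewrite RInt_const in P3. unfold scal in P3; simpl in P3. unfold mult in P3; simpl in P3.
  assert (Q : omega t * exp (- mu * (t + 1)) <= l + 1) by lra.
  rewrite Rmult_assoc, <- exp_plus.
  replace (- mu * (t + 1)) with (- (mu + mu * t)) in Q by ring.
  rewrite exp_Ropp in Q. apply Rle_div_l in Q; [lra | apply exp_pos].
Qed.

Lemma exp_integrable_of_exp_growth (omega : R -> R) (mu nu K : R) :
  weight_function omega -> 0 < nu -> nu < mu ->
  (forall t, 0 <= t -> omega t <= K * exp (nu * t)) -> exp_integrable omega mu.
Proof.
  intros Homega Hnu Hmu HK.
  set (f := fun t => omega t * exp (- mu * t)).
  assert (HK0 : 0 <= K).
  { generalize (HK 0 ltac:(lra)) (weight_nonneg _ Homega 0 ltac:(lra)).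
    rewrite Rmult_0_r, exp_0. lra. }
  assert (Hex : forall c d, 0 <= c -> c <= d -> ex_RInt f c d).
  { intros c d Hc Hd. apply (ex_RInt_Chasles_2 (V := R_CompleteNormedModule) f 0); [lra |].
    apply ex_RInt_weight_exp; trivial; lra. }
  set (d := mu - nu). assert (Hd : 0 < d) by (unfold d; lra).
  assert (Hbound : forall b, 0 <= b -> RInt f 0 b <= K / d).
  { intros b Hb.
    assert (HG : is_RInt (fun t => K * exp (- d * t)) 0 b
      (minus (- (K / d) * exp (- d * b)) (- (K / d) * exp (- d * 0)))).
    { apply (is_RInt_derive (V := R_CompleteNormedModule) (fun t => - (K / d) * exp (- d * t))).
      - intros t _. auto_derive; [trivial |]. field. lra.
      - intros t _. apply (ex_derive_continuous (V := R_NormedModule)).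
        auto_derive. trivial. }
    apply Rle_trans with (minus (- (K / d) * exp (- d * b)) (- (K / d) * exp (- d * 0))).
    - apply (is_RInt_le f (fun t => K * exp (- d * t)) 0 b); trivial.
      + apply (RInt_correct (V := R_CompleteNormedModule)), Hex; lra.
      + intros t Ht. unfold f.
        replace (- d * t) with (nu * t + - mu * t) by (unfold d; ring).
        rewrite exp_plus, <- Rmult_assoc.
        apply Rmult_le_compat_r; [apply Rlt_le, exp_pos | apply HK; lra].
    - unfold minus, plus, opp; simpl. rewrite Rmult_0_r, exp_0.
      assert (0 <= K / d) by (apply Rdiv_le_0_compat; lra).
      generalize (exp_pos (- d * b)). nra. }
  assert (Hmono : forall b c, 0 <= b -> b <= c -> RInt f 0 b <= RInt f 0 c).
  { intros b c Hb Hc.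
    rewrite <- (RInt_Chasles f 0 b c) by (apply Hex; lra).
    unfold plus; simpl.
    assert (0 <= RInt f b c); [| lra].
    apply RInt_ge_0; [lra | apply Hex; lra |].
    intros t Ht. apply Rmult_le_pos;
      [apply (weight_nonneg _ Homega); lra | apply Rlt_le, exp_pos]. }
  destruct (completeness (fun r => exists b, 0 <= b /\ r = RInt f 0 b)) as [l [Hub Hlub]].
  - exists (K / d). intros r (b & Hb & ->). now apply Hbound.
  - exists (RInt f 0 0), 0. split; [lra | reflexivity].
  - exists l. intros P [eps HP].
    assert (Hnear : exists b, 0 <= b /\ l - eps < RInt f 0 b).
    { apply NNPP. intros Hno.
      assert (l <= l - eps); [| generalize (cond_pos eps); lra].
      apply Hlub. intros r (b & Hb & ->). apply Rnot_lt_le. intros Hlt.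
      apply Hno. now exists b. }
    destruct Hnear as (b0 & Hb0 & Hnear).
    apply (Filter_prod _ _ _ (fun x => x = 0) (fun b => b0 < b)).
    + reflexivity.
    + now exists b0.
    + intros x b -> Hb. simpl in *.
      exists (RInt f 0 b). split.
      * apply (RInt_correct (V := R_CompleteNormedModule)), Hex; lra.
      * apply HP. unfold ball; simpl.
        unfold AbsRing_ball, abs, minus, plus, opp; simpl.
        assert (U := Hub _ (ex_intro _ b (conj (Rle_trans _ _ _ Hb0 (Rlt_le _ _ Hb)) eq_refl))).
        assert (V := Hmono b0 b Hb0 ltac:(lra)).
        apply Rabs_def1; generalize (cond_pos eps); lra.
Qed.

(** * The function spaces *)

Lemma weighted_norm_finite (omega : R -> R) (k lambda : R) (phi : C -> C) :
  Rbar_lt (weighted_norm omega k lambda phi) p_infty <->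
  exists M, forall z, strip k z ->
    Cmod (phi z) * exp (even_ext omega (lambda * Re z)) <= M.
Proof.
  unfold weighted_norm. set (E := fun r => _).
  destruct (Lub_Rbar_correct E) as [Hub Hlub].
  split.
  - intros Hlt.
    destruct (Lub_Rbar E) as [M | |]; [| contradiction |].
    + exists M. intros z Hz. apply (Hub _). now exists z.
    + exists 0. intros z Hz. exfalso.
      apply (Hub (Cmod (phi z) * exp (even_ext omega (lambda * Re z)))). now exists z.
  - intros [M HM]. apply (Rbar_le_lt_trans _ M); [| exact I].
    apply Hlub. intros r (z & Hz & ->). now apply HM.
Qed.

(** The function [exp (- A * cosh (a * z))]. *)
Definition exp_cosh (A a : R) (z : C) : C :=
  Cexp (RtoC (- A / 2) * (Cexp (RtoC a * z) + Cexp (RtoC (- a) * z)))%C.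

Lemma cdiff_exp_cosh (A a : R) (z : C) : cdiff (exp_cosh A a) z.
Proof.
  apply (cdiff_comp Cexp); [apply cdiff_Cexp |].
  apply cdiff_mult; [apply cdiff_const |].
  apply cdiff_plus; apply (cdiff_comp Cexp); try apply cdiff_Cexp;
    (apply cdiff_mult; [apply cdiff_const | apply cdiff_id]).
Qed.

Lemma exp_cosh_neq_0 (A a : R) (z : C) : exp_cosh A a z <> 0%C.
Proof. apply Cmod_gt_0. unfold exp_cosh. rewrite Cmod_Cexp. apply exp_pos. Qed.

(** The real part of [cosh (a * z)] is [cosh (a * x) * cos (a * y)], and [|a * y| <= PI / 3]
    on the strip, so the cosine is at least [1 / 2]. *)
Lemma Cmod_exp_cosh_le (A k : R) (z : C) :
  0 <= A -> 0 < k -> strip k z ->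
  Cmod (exp_cosh A (PI / (3 * k)) z) <= exp (- (A / 4 * exp (PI / (3 * k) * Rabs (Re z)))).
Proof.
  intros HA Hk Hz. set (a := PI / (3 * k)).
  assert (HPI := PI_RGT_0).
  assert (Ha : 0 < a) by (apply Rdiv_lt_0_compat; lra).
  unfold exp_cosh. rewrite Cmod_Cexp. apply exp_le.
  rewrite re_scal_l, re_plus.
  destruct z as [x y]. unfold strip, Im in Hz. simpl in Hz.
  unfold Cexp, Re, Im; simpl.
  replace (a * x - 0 * y) with (a * x) by ring.
  replace (a * y + 0 * x) with (a * y) by ring.
  replace (- a * x - 0 * y) with (- (a * x)) by ring.
  replace (- a * y + 0 * x) with (- (a * y)) by ring.
  rewrite cos_neg.
  assert (Hcos : 1 / 2 <= cos (a * y)).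
  { assert (E : a * k = PI / 3) by (unfold a; field; lra).
    assert (Rabs (a * y) <= PI / 3) by (rewrite <- E; apply Rabs_le; nra).
    rewrite <- cos_PI3.
    destruct (Rle_dec 0 (a * y)) as [Hp | Hp].
    - rewrite Rabs_pos_eq in H by exact Hp. apply cos_decr_1; lra.
    - rewrite Rabs_left in H by lra. rewrite <- (cos_neg (a * y)).
      apply cos_decr_1; lra. }
  assert (Hexp : exp (a * Rabs x) <= exp (a * x) + exp (- (a * x))).
  { assert (P1 := exp_pos (a * x)). assert (P2 := exp_pos (- (a * x))).
    destruct (Rle_dec 0 x) as [Hp | Hp].
    - rewrite Rabs_pos_eq by exact Hp. lra.
    - rewrite Rabs_left by lra. replace (a * - x) with (- (a * x)) by ring. lra. }
  assert (P := exp_pos (a * Rabs x)).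
  set (S := exp (a * x) + exp (- (a * x))) in *.
  replace (- A / 2 * (exp (a * x) * cos (a * y) + exp (- (a * x)) * cos (a * y)))
    with (- (A / 2 * (S * cos (a * y)))) by (unfold S; field).
  assert (exp (a * Rabs x) * (1 / 2) <= S * cos (a * y))
    by (apply Rmult_le_compat; lra).
  nra.
Qed.

Lemma roumieu_real_growth (omega : R -> R) :
  weight_function omega -> nontrivial (A_roumieu_real omega) -> eps_infty omega.
Proof.
  intros Homega (phi & (k & lambda & Hk & Hlambda & Hw & Han & Hnorm) & z0 & Hz0 & Hnz).
  rewrite Hw in Hz0.
  destruct (decay_bound phi k z0 Han Hz0 Hnz) as (mu0 & Hmu0 & Hgrowth).
  apply weighted_norm_finite in Hnorm. destruct Hnorm as [M HM].
  destruct (Hgrowth omega lambda M Homega Hlambda HM) as [K HK].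
  assert (0 < mu0 / lambda) by (apply Rdiv_lt_0_compat; lra).
  exists (mu0 / lambda + 1). split; [lra |].
  apply (exp_integrable_of_exp_growth omega _ (mu0 / lambda) K); trivial; lra.
Qed.

(** With [lambda = a / mu] the bound on [omega] becomes [K * exp (a * |x|)], which the
    choice [A = 4 * K] cancels exactly. *)
Lemma roumieu_nontrivial (omega : R -> R) (h : R) :
  weight_function omega -> 0 < h -> eps_infty omega -> nontrivial (A_roumieu omega h).
Proof.
  intros Homega Hh (mu & Hmu & Hint).
  destruct (exp_growth_of_exp_integrable omega mu Homega Hmu Hint) as [K HK].
  set (k := h + 1). set (a := PI / (3 * k)).
  assert (HPI := PI_RGT_0).
  assert (Ha : 0 < a) by (apply Rdiv_lt_0_compat; unfold k; lra).
  assert (HK0 : 0 <= K).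
  { generalize (HK 0 ltac:(lra)) (weight_nonneg _ Homega 0 ltac:(lra)).
    rewrite Rmult_0_r, exp_0. lra. }
  exists (StripFun k (exp_cosh (4 * K) a)). split.
  - exists k, (a / mu). split; [unfold k; lra |].
    split; [apply Rdiv_lt_0_compat; lra |].
    split; [reflexivity |]. split; [intros z _; apply cdiff_exp_cosh |].
    apply weighted_norm_finite. exists 1. intros z Hz. simpl.
    rewrite <- exp_0.
    eapply Rle_trans.
    + apply Rmult_le_compat_r; [apply Rlt_le, exp_pos |].
      apply Cmod_exp_cosh_le; trivial; unfold k; lra.
    + rewrite <- exp_plus. apply exp_le. fold a.
      assert (HK1 := HK (Rabs (a / mu * Re z)) (Rabs_pos _)).
      unfold even_ext.
      rewrite Rabs_mult, (Rabs_pos_eq (a / mu)) in * by (apply Rdiv_le_0_compat; lra).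
      replace (mu * (a / mu * Rabs (Re z))) with (a * Rabs (Re z)) in HK1 by (field; lra).
      lra.
  - exists 0%C. split; [unfold strip, k; simpl; unfold Im; simpl; lra |].
    apply exp_cosh_neq_0.
Qed.

(** The half-width [k < h] is chosen so that the smaller strip still contains a point
    where [phi] does not vanish. The weight [lambda = 2 * mu0 / mu] then turns the
    rate [mu0 / lambda] into [mu / 2], which is below the prescribed exponent. *)
Lemma beurling_growth (omega : R -> R) (h : R) :
  weight_function omega -> nontrivial (A_beurling omega h) -> eps_0 omega.
Proof.
  intros Homega (phi & (Hw & Han & Hnorm) & z0 & Hz0 & Hnz) mu Hmu.
  rewrite Hw in Hz0. unfold strip in Hz0.
  assert (Hz1 : Rabs (Im z0) < h) by (apply Rabs_def1; lra).
  set (k := (Rabs (Im z0) + h) / 2).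
  assert (Hpos := Rabs_pos (Im z0)).
  assert (Hk : strip k z0).
  { assert (Hlt : Rabs (Im z0) < k) by (unfold k; lra).
    apply Rabs_def2 in Hlt. unfold strip. lra. }
  destruct (decay_bound phi k z0) as (mu0 & Hmu0 & Hgrowth); trivial.
  { intros z Hz. apply Han. unfold strip, k in *. lra. }
  assert (Hl : 0 < 2 * mu0 / mu) by (apply Rdiv_lt_0_compat; lra).
  destruct (proj1 (weighted_norm_finite omega k (2 * mu0 / mu) phi)) as [M HM].
  { apply Hnorm; [unfold k; lra | exact Hl]. }
  destruct (Hgrowth omega _ M Homega Hl HM) as [K HK].
  apply (exp_integrable_of_exp_growth omega mu (mu / 2) K); try lra; trivial.
  intros t Ht. replace (mu / 2) with (mu0 / (2 * mu0 / mu)) by (field; lra).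
  now apply HK.
Qed.

(** For each [lambda] the growth condition is used at the exponent that gives
    [omega (lambda * x) <= K * e] with [e = exp (a * |x| / 2)], while the function decays
    like [exp (- e ^ 2 / 4)]; the loss is [K * e - e ^ 2 / 4 <= K ^ 2]. *)
Lemma beurling_nontrivial (omega : R -> R) (h : R) :
  weight_function omega -> 0 < h -> eps_0 omega -> nontrivial (A_beurling omega h).
Proof.
  intros Homega Hh Heps. set (a := PI / (3 * h)).
  assert (HPI := PI_RGT_0).
  assert (Ha : 0 < a) by (apply Rdiv_lt_0_compat; lra).
  exists (StripFun h (exp_cosh 1 a)). split.
  - split; [reflexivity |]. split; [intros z _; apply cdiff_exp_cosh |].
    intros k lambda Hk Hlambda.
    set (mu := a / (2 * lambda)).
    assert (Hmu : 0 < mu) by (apply Rdiv_lt_0_compat; lra).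
    destruct (exp_growth_of_exp_integrable omega mu Homega Hmu (Heps mu Hmu)) as [K HK].
    apply weighted_norm_finite. exists (exp (K * K)). intros z Hz. simpl.
    eapply Rle_trans.
    + apply Rmult_le_compat_r; [apply Rlt_le, exp_pos |].
      apply Cmod_exp_cosh_le; trivial; [lra |]. unfold strip in *. lra.
    + rewrite <- exp_plus. apply exp_le. fold a.
      assert (HK1 := HK (Rabs (lambda * Re z)) (Rabs_pos _)).
      unfold even_ext.
      rewrite Rabs_mult, (Rabs_pos_eq lambda) in * by lra.
      replace (mu * (lambda * Rabs (Re z))) with (a * Rabs (Re z) / 2) in HK1
        by (unfold mu; field; lra).
      replace (a * Rabs (Re z)) with (a * Rabs (Re z) / 2 + a * Rabs (Re z) / 2) by lra.
      rewrite exp_plus.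
      set (e := exp (a * Rabs (Re z) / 2)) in *.
      generalize (Rle_0_sqr (e / 2 - K)). unfold Rsqr. lra.
  - exists 0%C. split; [unfold strip; simpl; unfold Im; simpl; lra |].
    apply exp_cosh_neq_0.
Qed.

Theorem proposition4p3 (omega : R -> R) (h : R)
    (homega : weight_function omega) (hh : (0 < h)%R) :
  (nontrivial (A_beurling omega h) <-> eps_0 omega) /\
  (nontrivial (A_roumieu omega h) <-> eps_infty omega) /\
  (nontrivial (A_roumieu_real omega) <-> eps_infty omega).
Proof.
  assert (Hsub : nontrivial (A_roumieu omega h) -> nontrivial (A_roumieu_real omega)).
  { intros (phi & (k & lambda & Hk & Hphi) & Hnz).
    exists phi. split; [| exact Hnz]. exists k, lambda. split; [lra | exact Hphi]. }
  split; [| split]; split.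
  - now apply beurling_growth.
  - now apply beurling_nontrivial.
  - intros H. now apply roumieu_real_growth, Hsub.
  - now apply roumieu_nontrivial.
  - now apply roumieu_real_growth.
  - intros H. now apply Hsub, roumieu_nontrivial.
Qed.
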